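(* Let $\lambda\in(0,1]$, $\rho(k)=\sum_{i=0}^{k-1}\lambda^{i}$ and $\beta(k)=\sum_{i=0}^{k-1}\lambda^{-i}$. Let $\mathcal{A}$ be a learning-augmented, locally-consistent, memory-constrained deterministic online algorithm for the $k$-server problem on the line. Then, if $\mathcal{A}$ is $\rho(k)$-consistent, it is not $\beta'$-robust for any $\beta'<\beta(k)$ (i.e., it is at least $\beta(k)$-robust).
   Context: The $k$-server problem on the line: $k$ servers start at given positions on $\mathbb{R}$ (initial configuration); requests $r_1,\dots,r_n\in\mathbb{R}$ arrive online, each must be served by moving a server to it before the next one is revealed; cost is total distance traveled. Servers are labeled by position $s_1\le\dots\le s_k$. $\mathrm{OPT}(I)$ is the optimal offline cost. A prediction is a sequence $p_1,\dots,p_n\in\{1,\dots,k\}$ indicating the predicted server $s_{p_t}$ for request $t$; FtP serves each request by the predicted server, and the prediction error is $\eta=\mathrm{FtP}(I)-\mathrm{OPT}(I)$. An algorithm is $\alpha$-consistent if $\mathcal{A}(I)\le\alpha\,\mathrm{OPT}(I)+c$ whenever $\eta=0$, and $\beta$-robust if $\mathcal{A}(I)\le\beta\,\mathrm{OPT}(I)+c$ for all instances and predictions, with $c$ depending only on the initial configuration. Memory-constrained: each decision depends only on the current configuration, current request and current prediction; several servers may move per request; and for any $k$ distinct points and any configuration there is a finite request sequence among these points (a force) after which each point holds exactly one server. Locally-consistent: suppose $\mathcal{A}$ is $\mu(k')$-consistent for the $k'$-server problem for every $k'$. Given an instance $I$ served by $\mathcal{A}$ and any set $S'$ of $k'$ consecutive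 servers, build a $k'$-server instance $I'$: each request of $I$ predicted to be served by a server of $S'$ is copied to $I'$; any other request is replaced by a request at the position of the closest server of $S'$ after $\mathcal{A}$ served that request in $I$. Let $\mathrm{FtP}(I')$ be the cost of serving $I'$ following the original predictions (using the closest server of $S'$ when the predicted server is outside $S'$). $\mathcal{A}$ is locally-consistent if its total cost on $I$ restricted to the servers of $S'$ is at most $\mu(k')\cdot\mathrm{FtP}(I')+c$, where $c$ can be bounded in terms of the initial configuration only, and $c=O(k'\varepsilon)$ if the initial and final configurations differ by total distance $\varepsilon$. *)

(* Defs.v *)
From HB Require Import structures.
From mathcomp Require Import all_boot all_order all_algebra.
From mathcomp Require Import boolp classical_sets reals.
Set Implicit Arguments. Unset Strict Implicit. Unset Printing Implicit Defensive.
Import Order.TTheory GRing.Theory Num.Theory.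
Local Open Scope ring_scope.

Section KServer.
Variable R : realType.

(* A configuration of k servers is a seq R of size k (a multiset of positions).
   Servers are labeled by position: server number i (0-indexed) is the i-th
   smallest position. *)
Definition srv (C : seq R) (i : nat) : R := nth 0 (sort <=%R C) i.

(* Movement cost between two configurations of the same size: on the line the
   minimum total distance is the sorted matching. *)
Definition dist (C C' : seq R) : R :=
  \sum_(i < size C) `|srv C i - srv C' i|.

Definition dist_on (j0 k' : nat) (C C' : seq R) : R :=
  \sum_(j0 <= i < j0 + k') `|srv C i - srv C' i|.

(* A memory-constrained deterministic online algorithm with predictions:
   new configuration as a function of (current configuration, current request,
   current prediction).  Predictions are 0-indexed labels p < k.
   The same algorithm runs for every number k of servers (k = size C). *)
Definition alg := seq R -> R -> nat -> seq R.

Definition valid_alg (A : alg) : Prop :=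
  forall (C : seq R) (r : R) (p : nat), (0 < size C)%N -> (p < size C)%N ->
    size (A C r p) = size C /\ r \in A C r p.

Fixpoint alg_cost (A : alg) (C : seq R) (s : seq (R * nat)) : R :=
  if s is rp :: s' then dist C (A C rp.1 rp.2) + alg_cost A (A C rp.1 rp.2) s'
  else 0.

Fixpoint alg_cost_on (j0 k' : nat) (A : alg) (C : seq R) (s : seq (R * nat)) : R :=
  if s is rp :: s' then
    dist_on j0 k' C (A C rp.1 rp.2) + alg_cost_on j0 k' A (A C rp.1 rp.2) s'
  else 0.

Fixpoint alg_final (A : alg) (C : seq R) (s : seq (R * nat)) : seq R :=
  if s is rp :: s' then alg_final A (A C rp.1 rp.2) s' else C.

Definition ftp_step : alg := fun C r p => set_nth 0 (sort <=%R C) p r.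

Definition FtP (C0 : seq R) (s : seq (R * nat)) : R := alg_cost ftp_step C0 s.

Fixpoint sched_ok (C : seq R) (rs : seq R) (Cs : seq (seq R)) : bool :=
  match rs, Cs with
  | [::], [::] => true
  | r :: rs', C' :: Cs' => [&& size C' == size C, r \in C' & sched_ok C' rs' Cs']
  | _, _ => false
  end.

Fixpoint sched_cost (C : seq R) (Cs : seq (seq R)) : R :=
  if Cs is C' :: Cs' then dist C C' + sched_cost C' Cs' else 0.

Definition OPT (C0 : seq R) (rs : seq R) : R :=
  inf [set x : R | exists Cs, sched_ok C0 rs Cs /\ x = sched_cost C0 Cs].

Definition valid_preds (k : nat) (s : seq (R * nat)) : bool :=
  all (fun rp => (rp.2 < k)%N) s.

(* alpha-consistency for the k-server problem (prediction error eta = 0). *)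
Definition consistent (A : alg) (k : nat) (alpha : R) : Prop :=
  exists c : seq R -> R, forall (C0 : seq R) (s : seq (R * nat)),
    size C0 = k -> valid_preds k s ->
    FtP C0 s - OPT C0 (map fst s) = 0 ->
    alg_cost A C0 s <= alpha * OPT C0 (map fst s) + c C0.

Definition robust (A : alg) (k : nat) (beta : R) : Prop :=
  exists c : seq R -> R, forall (C0 : seq R) (s : seq (R * nat)),
    size C0 = k -> valid_preds k s ->
    alg_cost A C0 s <= beta * OPT C0 (map fst s) + c C0.

(* Memory-constrained: decisions depend only on (configuration, request,
   prediction) -- built into the type [alg] -- and forcing: for any k distinct
   points and any configuration there is a finite request sequence among these
   points after which each point holds exactly one server. *)
Definition memory_constrained (A : alg) : Prop :=
  forall (P C : seq R), (0 < size P)%N -> uniq P -> size C = size P ->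
    exists s : seq (R * nat),
      all (fun rp => rp.1 \in P) s /\ valid_preds (size P) s /\
      perm_eq (alg_final A C s) P.

Definition sub_conf (j0 k' : nat) (C : seq R) : seq R := take k' (drop j0 (sort <=%R C)).

Definition closest (j0 k' : nat) (C : seq R) (r : R) : R :=
  let L := sub_conf j0 k' C in
  foldr (fun x best => if `|x - r| < `|best - r| then x else best) (head 0 L) L.

Fixpoint sub_inst (j0 k' : nat) (A : alg) (C : seq R) (s : seq (R * nat)) : seq (R * nat) :=
  if s is rp :: s' then
    let C' := A C rp.1 rp.2 in
    (if (j0 <= rp.2 < j0 + k')%N then (rp.1, (rp.2 - j0)%N)
     else (closest j0 k' C' rp.1, if (rp.2 < j0)%N then 0%N else k'.-1))
    :: sub_inst j0 k' A C' s'
  else [::].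

(* Locally-consistent w.r.t. mu: A is mu(k')-consistent for every k', and for
   every instance and every block S' of k' consecutive servers the cost of A
   restricted to S' is at most mu(k') * FtP(I') + c, with c bounded by a function
   of the initial configuration and by K * k' * eps, eps being the total
   distance between the initial and final configurations. *)
Definition locally_consistent (A : alg) (mu : nat -> R) : Prop :=
  (forall k', (0 < k')%N -> consistent A k' (mu k')) /\
  exists (B : seq R -> R) (K : R),
    forall (C0 : seq R) (s : seq (R * nat)) (j0 k' : nat),
      valid_preds (size C0) s -> (0 < k')%N -> (j0 + k' <= size C0)%N ->
      alg_cost_on j0 k' A C0 s <=
        mu k' * FtP (sub_conf j0 k' C0) (sub_inst j0 k' A C0 s)
        + Num.min (B C0) (K * k'%:R * dist C0 (alg_final A C0 s)).

Definition rho (lam : R) (k : nat) : R := \sum_(i < k) lam ^+ i.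
Definition beta (lam : R) (k : nat) : R := \sum_(i < k) lam ^- i.

End KServer.

(* Main.v *)
Require Import Defs.
From HB Require Import structures.
From mathcomp Require Import all_boot all_order all_algebra.
From mathcomp Require Import boolp classical_sets reals.
From mathcomp Require Import zify lra.
Set Implicit Arguments. Unset Strict Implicit. Unset Printing Implicit Defensive.
Import Order.TTheory GRing.Theory Num.Theory.
Local Open Scope ring_scope.

(** Number the servers 0, ..., n (k = n + 1) and place the sites 0, 1, 1 + g,
    1 + 2g, ... for a huge g, with one more point, [far], next to the last site.
    Follow-the-prediction keeps server j on site j and lets only server n commute
    between site n and [far].  The adversary requests [far] and the sites 1, ..., n
    over and over; whenever site 1 is answered by server 0 instead of server 1,
    server 0 is sent back by a request to site 0.

    Local consistency for the block of all servers, started at an arbitrary moment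
    of the run, bounds every excursion of A by a constant independent of g, so no
    two servers from 1 on ever exchange their roles.  Consequently, on the block of
    servers 0, ..., i, follow-the-prediction merely tracks server i of A: with T_j
    the distance travelled by server j, local consistency yields
    T_0 + ... + T_i <= rho(i + 1) T_i + O(1) for 1 <= i <= n.  These inequalities
    chain to a total cost of at least beta(k) T_0 - O(1).  If site 0 is requested N
    times then T_0 >= 2N, whereas offline the servers wait on all sites but site 0
    and pay 2N + O(1).  Every round costs A at least 1, so robustness makes N
    unbounded, and beta' < beta(k) is impossible. *)

Ltac norm_lra :=
  intros;
  repeat match goal with H : context [ `| _ | ] |- _ => move: H end;
  repeat (match goal with |- context [ `| ?x | ] => case: (ger0P x) => ? end);
  intros; lra.

(** * Sorted matchings and the follow-the-prediction potential *)

Section Matching.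
Context {R : realType}.
Implicit Types (C D Z p u v : seq R).

Lemma srv_le C i j : (i <= j)%N -> (j < size C)%N -> srv C i <= srv C j.
Proof.
move=> ij jC; rewrite /srv.
have lei : (i < size C)%N by exact: leq_ltn_trans ij jC.
have := sort_le_sorted C.
by move=> /(sorted_leq_nth le_trans le_refl 0); apply; rewrite ?inE ?size_sort.
Qed.

Lemma mem_srv C r : r \in C -> exists2 i, (i < size C)%N & srv C i = r.
Proof.
by rewrite -(mem_sort <=%R) => /(nthP 0)[i iC <-]; exists i; rewrite // -(size_sort <=%R).
Qed.

Lemma srv_sorted p i : sorted <=%R p -> srv p i = p`_i.
Proof. by move=> sp; rewrite /srv sort_le_id. Qed.

Lemma srv_sort C i : srv (sort <=%R C) i = srv C i.
Proof. by rewrite srv_sorted ?sort_le_sorted. Qed.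

Definition pairing u v : R := \sum_(x <- zip u v) `|x.1 - x.2|.

(** Insertion sort recurses on the list, so the exchange argument becomes a plain induction;
    [sort_isort] identifies its result with that of [sort]. *)
Fixpoint insert (x : R) u :=
  if u is y :: u' then if x <= y then x :: u else y :: insert x u' else [:: x].

Definition isort u := foldr insert [::] u.

Lemma perm_insert x u : perm_eq (insert x u) (x :: u).
Proof.
elim: u => //= y u IH; case: ifP => // _.
rewrite -(perm_cons y) in IH; apply: perm_trans IH _.
by apply/permP => a /=; rewrite addnCA.
Qed.

Lemma perm_isort u : perm_eq (isort u) u.
Proof.
elim: u => //= x u IH; apply: perm_trans (perm_insert _ _) _.
by rewrite perm_cons.
Qed.

Lemma sorted_insert x u : sorted <=%R u -> sorted <=%R (insert x u).
Proof.
elim: u => //= y u IH yu; case: ifP => [xy|/negbT]; first by rewrite /= xy.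
rewrite -ltNge => yx; case: u IH yu => [|z u] IH /=; first by rewrite ltW.
case/andP=> yz zu; move: (IH zu) => /=; case: ifP => _ /= H.
  by rewrite (ltW yx).
by rewrite yz.
Qed.

Lemma sort_isort u : sort <=%R u = isort u.
Proof.
apply: (sorted_eq le_trans le_anti) => //; first exact: sort_le_sorted.
  by elim: u => //= x u; apply: sorted_insert.
by rewrite perm_sort perm_sym perm_isort.
Qed.

(** Each step of the insertion swaps [x] with a smaller [y]. Matched against the sorted [v] these
    two pairs cross, and uncrossing them cannot raise the sum. *)
Lemma pairing_insert x u v : size v = (size u).+1 -> sorted <=%R v ->
  pairing (insert x u) v <= pairing (x :: u) v.
Proof.
elim: u x v => [|y u IH] x [|b [|c v]] //= [sv] /andP[bc cv].
case: ifP => // /negbT; rewrite -ltNge => yx.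
rewrite /pairing /= !big_cons /=.
have := IH x (c :: v); rewrite /pairing /= => /(_ _ cv); rewrite sv => /(_ erefl).
rewrite big_cons /=; set s := \sum_(_ <- _) _; set t := \sum_(_ <- _) _.
norm_lra.
Qed.

Lemma pairing_isort u v : size u = size v -> sorted <=%R v ->
  pairing (isort u) v <= pairing u v.
Proof.
elim: u v => [|x u IH] [|b v] //= [suv] bv.
rewrite -/(isort u); apply: le_trans (@pairing_insert x (isort u) (b :: v) _ bv) _.
  by rewrite /= -suv (perm_size (perm_isort u)).
rewrite /pairing /= !big_cons lerD2l; apply: IH => //.
exact: path_sorted bv.
Qed.

Lemma pairingE u v : size u = size v ->
  pairing u v = \sum_(i < size u) `|u`_i - v`_i|.
Proof.
move=> suv; rewrite /pairing (big_nth (0, 0)) size_zip suv minnn big_mkord.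
by apply: eq_bigr => i _; rewrite nth_zip.
Qed.

(** Reordering the pairs by second component keeps the sum and sorts [v]; sorting the first
    components against it can only lower the sum. *)
Lemma dist_le_pairing u v : size u = size v ->
  dist u v <= \sum_(i < size u) `|u`_i - v`_i|.
Proof.
move=> suv; rewrite -pairingE //.
pose s := sort (relpre snd <=%R) (zip u v).
have ps : perm_eq s (zip u v) by rewrite perm_sort.
have e1 : perm_eq (unzip1 s) u.
  by rewrite -[X in perm_eq _ X](@unzip1_zip _ _ u v) ?suv //; apply: perm_map.
have e2 : unzip2 s = sort <=%R v.
  by rewrite -[in RHS](@unzip2_zip _ _ u v) ?suv // sort_map.
have -> : pairing u v = pairing (unzip1 s) (unzip2 s).
  by rewrite /pairing zip_unzip; apply: perm_big; rewrite perm_sym.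
have ss : size (unzip1 s) = size (unzip2 s) by rewrite !size_map.
apply: le_trans (pairing_isort ss _); last by rewrite e2 sort_le_sorted.
rewrite -sort_isort e2.
have -> : sort <=%R (unzip1 s) = sort <=%R u by apply/perm_sort_leP.
by rewrite pairingE ?size_sort.
Qed.

Lemma dist_ge0 u v : 0 <= dist u v.
Proof. exact: sumr_ge0. Qed.

Lemma dist_triangle u v w : size u = size v -> dist u w <= dist u v + dist v w.
Proof.
rewrite /dist => suv; rewrite -suv -big_split /=; apply: ler_sum => i _.
exact: ler_distD.
Qed.

Lemma distC u v : size u = size v -> dist u v = dist v u.
Proof.
by move=> suv; rewrite /dist suv; apply: eq_bigr => i _; rewrite distrC.
Qed.

Lemma srv_dist_le (u v : seq R) i : (i < size u)%N -> `|srv u i - srv v i| <= dist u v.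
Proof.
by move=> iu; rewrite /dist (bigD1 (Ordinal iu)) //= lerDl sumr_ge0.
Qed.

Lemma size_ftp_step Z r j : (j < size Z)%N -> size (ftp_step Z r j) = size Z.
Proof.
by move=> jZ; rewrite /ftp_step size_set_nth size_sort; apply/maxn_idPr.
Qed.

Lemma dist_ftp_step Z r j : (j < size Z)%N ->
  dist Z (ftp_step Z r j) <= `|srv Z j - r|.
Proof.
move=> jZ; have sZ := size_ftp_step r jZ.
have -> : dist Z (ftp_step Z r j) = dist (sort <=%R Z) (ftp_step Z r j).
  by rewrite /dist size_sort; apply: eq_bigr => i _; rewrite srv_sort.
apply: le_trans (dist_le_pairing _) _; first by rewrite size_sort.
rewrite size_sort (bigD1 (Ordinal jZ)) //= big1 ?addr0.
  by rewrite /ftp_step nth_set_nth /= eqxx.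
by move=> i /eqP ij; rewrite /ftp_step nth_set_nth /= ifN ?subrr ?normr0 //;
  apply/eqP => e; apply: ij; apply: val_inj.
Qed.

(* The distance of the follow-the-prediction configuration to a fixed target
   serves as potential. *)
Lemma ftp_step_potential Z p r j : (j < size Z)%N -> size p = size Z -> sorted <=%R p ->
  dist Z (ftp_step Z r j) + dist (ftp_step Z r j) p <=
    dist Z p - `|srv Z j - p`_j| + `|srv Z j - r| + `|r - p`_j|.
Proof.
move=> jZ sp srt; have sZ := size_ftp_step r jZ.
have dZ : dist Z p = `|srv Z j - p`_j| + \sum_(i < size Z | i != Ordinal jZ) `|srv Z i - p`_i|.
  rewrite /dist (bigD1 (Ordinal jZ)) //= (srv_sorted _ srt).
  by congr (_ + _); apply: eq_bigr => i _; rewrite (srv_sorted _ srt).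
have H : dist (ftp_step Z r j) p <= dist Z p - `|srv Z j - p`_j| + `|r - p`_j|.
  apply: le_trans (dist_le_pairing _) _; first by rewrite sZ.
  rewrite sZ (bigD1 (Ordinal jZ)) //= /ftp_step nth_set_nth /= eqxx dZ.
  rewrite [leRHS](_ : _ = `|r - p`_j| + \sum_(i < size Z | i != Ordinal jZ) `|srv Z i - p`_i|);
    last by lra.
  rewrite lerD2l; apply: ler_sum => i /eqP ij.
  rewrite nth_set_nth /= ifN //.
  by apply/eqP => e; apply: ij; apply: val_inj.
have := dist_ftp_step r jZ; lra.
Qed.

End Matching.

(** * Runs and full-block local consistency *)

Section Runs.
Context {R : realType}.
Implicit Types (A : alg R) (C D Z p : seq R) (s : seq (R * nat)).

Lemma alg_final_cat A C s s' :
  alg_final A C (s ++ s') = alg_final A (alg_final A C s) s'.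
Proof. by elim: s C => //= x s IH C. Qed.

Lemma alg_cost_cat A C s s' :
  alg_cost A C (s ++ s') = alg_cost A C s + alg_cost A (alg_final A C s) s'.
Proof. by elim: s C => [|x s IH] C /=; rewrite ?add0r // IH addrA. Qed.

Lemma alg_cost_ge0 A C s : 0 <= alg_cost A C s.
Proof. by elim: s C => //= x s IH C; rewrite addr_ge0 ?dist_ge0. Qed.

Lemma sub_inst_cat j0 k' A C s s' :
  sub_inst j0 k' A C (s ++ s') =
  sub_inst j0 k' A C s ++ sub_inst j0 k' A (alg_final A C s) s'.
Proof. by elim: s C => //= x s IH C; rewrite IH. Qed.

Fixpoint srv_path A (i : nat) C s : R :=
  if s is x :: s' then `|srv C i - srv (A C x.1 x.2) i| + srv_path A i (A C x.1 x.2) s'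
  else 0.

Lemma srv_path_ge0 A i C s : 0 <= srv_path A i C s.
Proof. by elim: s C => //= x s IH C; rewrite addr_ge0. Qed.

Lemma srv_path_cat A i C s s' :
  srv_path A i C (s ++ s') = srv_path A i C s + srv_path A i (alg_final A C s) s'.
Proof. by elim: s C => [|x s IH] C /=; rewrite ?add0r // IH addrA. Qed.

Lemma srv_path_ge A i C s : `|srv C i - srv (alg_final A C s) i| <= srv_path A i C s.
Proof.
elim: s C => [|x s IH] C /=; first by rewrite subrr normr0.
by apply: le_trans (ler_distD (srv (A C x.1 x.2) i) _ _) _; rewrite lerD2l.
Qed.

Lemma alg_cost_onE A m C s :
  alg_cost_on 0 m A C s = \sum_(i < m) srv_path A i C s.
Proof.
elim: s C => [|x s IH] C /=; first by rewrite big1.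
by rewrite IH big_split /= /dist_on add0n big_mkord.
Qed.

Section Valid.
Variable A : alg R.
Hypothesis vA : valid_alg A.

Lemma size_alg_final C s : (0 < size C)%N -> valid_preds (size C) s ->
  size (alg_final A C s) = size C.
Proof.
elim: s C => //= x s IH C C0 /andP[xC sC].
by have [e _] := vA x.1 C0 xC; rewrite IH e.
Qed.

Lemma alg_costE C s : (0 < size C)%N -> valid_preds (size C) s ->
  alg_cost A C s = \sum_(i < size C) srv_path A i C s.
Proof.
elim: s C => [|x s IH] C C0 /=; first by rewrite big1.
move=> /andP[xC sC]; have [e _] := vA x.1 C0 xC.
by rewrite IH e // big_split.
Qed.

Lemma srv_path_le_cost i C s : (i < size C)%N -> valid_preds (size C) s ->
  srv_path A i C s <= alg_cost A C s.
Proof.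
move=> iC sC; rewrite alg_costE ?(leq_ltn_trans _ iC) //.
rewrite (bigD1 (Ordinal iC)) //= lerDl; apply: sumr_ge0 => j _; exact: srv_path_ge0.
Qed.

Lemma srv_final_le_cost i C s : (i < size C)%N -> valid_preds (size C) s ->
  `|srv C i - srv (alg_final A C s) i| <= alg_cost A C s.
Proof. by move=> iC sC; apply: le_trans (srv_path_ge _ _ _ _) (srv_path_le_cost iC sC). Qed.

(** Some server stands on [x.1] when [x] is answered; what it travels afterwards bounds its final
    distance from there. *)
Lemma served_close C s x : x \in s -> (0 < size C)%N -> valid_preds (size C) s ->
  exists2 i, (i < size C)%N & `|srv (alg_final A C s) i - x.1| <= srv_path A i C s.
Proof.
elim: s C => //= z s IH C; rewrite inE => H C0 /andP[zC sC].
have [e zin] := vA z.1 C0 zC.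
have [/eqP ->|xs] := orP H.
  have [i iC sr] := mem_srv zin; exists i; first by rewrite -e.
  rewrite -[X in _ - X]sr distrC; apply: le_trans (srv_path_ge _ _ _ _) _.
  by rewrite lerDr.
have := IH (A C z.1 z.2) xs; rewrite e => /(_ C0 sC)[i iC Hi].
by exists i => //; apply: le_trans Hi _; rewrite lerDr.
Qed.

End Valid.

Definition gapped p := forall j, (j.+1 < size p)%N -> p`_j + 1 <= p`_j.+1.

Lemma gapped_sorted p : gapped p -> sorted <=%R p.
Proof.
move=> gp; apply/(sortedP 0) => j jp; have := gp j jp; lra.
Qed.

(** With unit gaps and tolerances below one half, servers found at neighbouring points have strictly
    increasing labels. Induction from the left gives [j <= i], from the right [i <= j]. The
    tolerance is indexed by the server so that its own path length can be used. *)
Lemma gapped_match C p (pi : nat -> R) : gapped p -> size C = size p ->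
  (forall i, pi i < 2^-1) ->
  (forall j, (j < size p)%N ->
     exists2 i, (i < size p)%N & `|srv C i - p`_j| <= pi i) ->
  forall j, (j < size p)%N -> `|srv C j - p`_j| <= pi j.
Proof.
move=> gp sC pih ex.
have lt_idx i i' j : (j.+1 < size p)%N -> (i < size p)%N -> (i' < size p)%N ->
    `|srv C i - p`_j| <= pi i -> `|srv C i' - p`_j.+1| <= pi i' -> (i < i')%N.
  move=> jp ip ip' h h'; rewrite ltnNge; apply/negP => ii.
  have := @srv_le _ C _ _ ii; rewrite sC => /(_ ip) le.
  have : srv C i < srv C i'.
    clear le ex; have := gp _ jp; have := pih i; have := pih i'; norm_lra.
  by rewrite ltNge le.
have lb j i : (j < size p)%N -> (i < size p)%N -> `|srv C i - p`_j| <= pi i -> (j <= i)%N.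
  elim: j i => // j IH i jp ip h; have [i0 ip0 h0] := ex j (ltnW jp).
  exact: leq_ltn_trans (IH i0 (ltnW jp) ip0 h0) (lt_idx _ _ _ jp ip0 ip h0 h).
have ub d j i : (j + d.+1 = size p)%N -> (i < size p)%N -> `|srv C i - p`_j| <= pi i -> (i <= j)%N.
  elim: d j i => [|d IH] j i jd ip h; first by lia.
  have jp : (j.+1 < size p)%N by lia.
  have [i0 ip0 h0] := ex _ jp.
  have := IH j.+1 i0; have := lt_idx _ _ _ jp ip ip0 h h0; lia.
move=> j jp; have [i ip h] := ex j jp.
suff e : i = j by move: h; rewrite e.
apply/eqP; rewrite eqn_leq (lb j i) // andbT.
by apply: (ub (size p - j.+1)%N) => //; lia.
Qed.

Definition on_points p s := all (fun x => (x.2 < size p)%N && (x.1 == p`_(x.2))) s.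

Lemma on_points_valid p s : on_points p s -> valid_preds (size p) s.
Proof. by apply: sub_all => x /andP[]. Qed.

(** A request at the target of its predicted server is paid for by the decrease of the potential. *)
Lemma ftp_on_points Z p s : size Z = size p -> sorted <=%R p -> on_points p s ->
  alg_cost (@ftp_step R) Z s + dist (alg_final (@ftp_step R) Z s) p <= dist Z p.
Proof.
move=> + srt; elim: s Z => [|x s IH] Z sZ /=; first by rewrite add0r.
move=> /andP[/andP[xp /eqP xE] sp].
have xZ : (x.2 < size Z)%N by rewrite sZ.
have := IH (ftp_step Z x.1 x.2); rewrite size_ftp_step // => /(_ sZ sp).
have := ftp_step_potential x.1 xZ (esym sZ) srt; rewrite xE subrr normr0.
lra.
Qed.

Lemma bounded_small_step (f : nat -> R) (H : R) : 0 <= f 0%N -> (forall n, f n <= H) ->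
  exists n, f n.+1 < f n + 2^-1.
Proof.
move=> f0 fH; apply: contrapT => nex.
have st n : f n + 2^-1 <= f n.+1.
  by rewrite leNgt; apply/negP => h; apply: nex; exists n.
have lin n : n%:R / 2 <= f n.
  by elim: n => [|n IH]; [rewrite mul0r | have := st n; rewrite -[n.+1%:R]natr1; lra].
have hb : 2 * `|H| < (Num.bound (2 * `|H|))%:R by apply: archi_boundP; rewrite mulr_ge0.
have := le_trans (lin _) (fH (Num.bound (2 * `|H|))).
rewrite leNgt => /negP; apply; have := ler_norm H; lra.
Qed.

Lemma sched_cost_ge0 C Cs : 0 <= sched_cost C Cs.
Proof. by elim: Cs C => //= C' Cs IH C; rewrite addr_ge0 ?dist_ge0. Qed.

Lemma OPT_le_sched C rs Cs : sched_ok C rs Cs -> OPT C rs <= sched_cost C Cs.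
Proof.
move=> h; apply: ge_inf; last by exists Cs.
by exists 0 => _ [Ds [_ ->]]; exact: sched_cost_ge0.
Qed.

Lemma OPT_ge0 C rs : 0 <= OPT C rs.
Proof.
rewrite /OPT; set E := [set _ | _]%classic.
have [->|/set0P E0] := eqVneq E set0; first by rewrite inf0.
by apply: lb_le_inf => // _ [Ds [_ ->]]; exact: sched_cost_ge0.
Qed.

Section FullBlock.
Variables (A : alg R) (mu : nat -> R) (B : seq R -> R) (K : R).
Hypothesis vA : valid_alg A.
Hypothesis mu_ge0 : forall m, 0 <= mu m.
Hypothesis loc : forall (C0 : seq R) (s : seq (R * nat)) (j0 k' : nat),
  valid_preds (size C0) s -> (0 < k')%N -> (j0 + k' <= size C0)%N ->
  alg_cost_on j0 k' A C0 s <=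
    mu k' * FtP (sub_conf j0 k' C0) (sub_inst j0 k' A C0 s)
    + Num.min (B C0) (K * k'%:R * dist C0 (alg_final A C0 s)).

Lemma sub_inst_full m C s : valid_preds m s -> sub_inst 0 m A C s = s.
Proof.
elim: s C => //= x s IH C /andP[xm sm].
by rewrite add0n xm subn0 IH // -surjective_pairing.
Qed.

(** For the block of all servers the restricted instance is the instance itself and the restricted
    cost is the whole cost. *)
Lemma full_block q s : (0 < size q)%N -> valid_preds (size q) s ->
  alg_cost A q s <= mu (size q) * FtP (sort <=%R q) s
    + Num.min (B q) (K * (size q)%:R * dist q (alg_final A q s)).
Proof.
move=> q0 sq; have := @loc q s 0 (size q) sq q0 (leqnn _).
by rewrite alg_cost_onE (alg_costE vA q0 sq) sub_inst_full // /sub_conf drop0 take_oversize ?size_sort.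
Qed.

(* Appending rounds of requests on which follow-the-prediction rests drives A
   towards the resting positions; the loop then closes and the additive constant
   of local consistency is controlled by the distance from q to these positions. *)
Lemma cost_le_ftp_potential q p s phi : (0 < size q)%N -> size p = size q -> gapped p ->
  valid_preds (size q) s ->
  alg_cost (@ftp_step R) (sort <=%R q) s
    + dist (alg_final (@ftp_step R) (sort <=%R q) s) p <= phi ->
  alg_cost A q s <= mu (size q) * phi + `|K| * (size q)%:R * (dist q p + 1).
Proof.
move=> q0 sp gp sq hphi.
have srt := gapped_sorted gp.
pose rd := [seq (p`_j, j) | j <- iota 0 (size p)].
pose rds n := flatten (nseq n rd).
have rdp : on_points p rd.
  by apply/allP => x /mapP[j]; rewrite mem_iota /= add0n => jp -> /=; rewrite jp eqxx.
have rdsp n : on_points p (rds n).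
  by elim: n => // n IH; rewrite /on_points all_cat; apply/andP; split.
have rdsS n : rds n.+1 = rds n ++ rd.
  by rewrite /rds -addn1 nseqD flatten_cat /= cats0.
have vrd n : valid_preds (size q) (s ++ rds n).
  by rewrite /valid_preds all_cat; apply/andP; split=> //; rewrite -sp; apply: on_points_valid.
have sqs : size (alg_final (@ftp_step R) (sort <=%R q) s) = size p.
  have : size (sort <=%R q) = size p by rewrite size_sort.
  move: sq; rewrite -sp; elim: (s) (sort _ _) => //= x t IH Z /andP[xp tp] sZ.
  by rewrite IH // size_ftp_step ?sZ.
have ftpb n : FtP (sort <=%R q) (s ++ rds n) <= phi.
  rewrite /FtP alg_cost_cat; apply: le_trans hphi; rewrite lerD2l.
  apply: le_trans (ftp_on_points sqs srt (rdsp n)).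
  by rewrite lerDl dist_ge0.
(* [phi] bounds follow-the-prediction for every number of rounds and [B q] bounds the additive term,
   so A pays less than one half on some round. *)
have [n hn] : exists n, alg_cost A q (s ++ rds n.+1) < alg_cost A q (s ++ rds n) + 2^-1.
  apply: (@bounded_small_step _ (mu (size q) * phi + B q)); first exact: alg_cost_ge0.
  move=> n; apply: le_trans (full_block q0 (vrd n)) _.
  apply: lerD; first by apply: ler_wpM2l.
  by rewrite ge_min lexx.
set C := alg_final A q (s ++ rds n); set C' := alg_final A q (s ++ rds n.+1).
have sC : size C = size p by rewrite /C size_alg_final.
have C0 : (0 < size C)%N by rewrite sC sp.
have vC : valid_preds (size C) rd by rewrite sC; apply: on_points_valid.
have eC' : C' = alg_final A C rd by rewrite /C' rdsS catA alg_final_cat.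
have crd : alg_cost A C rd < 2^-1.
  by move: hn; rewrite rdsS catA (alg_cost_cat _ _ (s ++ rds n)) ltrD2l.
have sC' : size C' = size p by rewrite eC' size_alg_final.
(* The cheap round serves every point of [p], so each point keeps a server within one half of it. *)
have cl j : (j < size p)%N -> `|srv C' j - p`_j| <= srv_path A j C rd.
  move=> jp; pose pi i := if (i < size p)%N then srv_path A i C rd else 0.
  have := @gapped_match C' p pi gp sC'.
  have -> : srv_path A j C rd = pi j by rewrite /pi jp.
  apply=> //.
  - move=> i; rewrite /pi; case: ifP => ip; last by rewrite invr_gt0.
    by apply: le_lt_trans crd; apply: (srv_path_le_cost vA _ vC); rewrite sC.
  - move=> l lp; have xin : (p`_l, l) \in rd.
      by apply/mapP; exists l; rewrite // mem_iota.
    have [i iC h] := served_close vA xin C0 vC.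
    by exists i; rewrite -?sC // /pi -sC iC eC'.
have dC' : dist C' p <= 2^-1.
  apply: ltW; apply: le_lt_trans crd; rewrite alg_costE // sC /dist sC'.
  by apply: ler_sum => i _; rewrite (srv_sorted _ srt); apply: cl.
have dq : dist q C' <= dist q p + 1.
  apply: le_trans (dist_triangle _ (esym sp)) _; rewrite lerD2l.
  by rewrite distC ?sC' //; lra.
have h1 : alg_cost A q s <= alg_cost A q (s ++ rds n.+1).
  by rewrite alg_cost_cat lerDl alg_cost_ge0.
apply: le_trans h1 _; apply: le_trans (full_block q0 (vrd _)) _.
apply: lerD; first by apply: ler_wpM2l.
(* Now the other branch of the minimum is taken: the run ends close to [p], so [B q], over which
   there is no uniform control in [q], disappears from the bound. *)
rewrite ge_min; apply/orP; right.
apply: le_trans (_ : `|K| * (size q)%:R * dist q C' <= _).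
  by apply: ler_wpM2r; [exact: dist_ge0 | apply: ler_wpM2r; rewrite ?ler0n ?ler_norm].
by apply: ler_wpM2l => //; rewrite mulr_ge0 ?ler0n.
Qed.

End FullBlock.
End Runs.

Lemma first_split (T : Type) (a : pred T) (s : seq T) : has a s ->
  exists s1 x s2, [/\ s = s1 ++ x :: s2, all (predC a) s1 & a x].
Proof.
elim: s => //= z s IH; case az: (a z) => /=; first by exists [::], z, s.
by move=> /IH[s1 [x [s2 [-> h ax]]]]; exists (z :: s1), x, s2; rewrite /= az.
Qed.

(** * Requests to the right of a prefix block *)

Section Closest.
Context {R : realType}.
Implicit Types (C L : seq R).

Lemma closest_fold (r x0 : R) L :
  let v := foldr (fun x best => if `|x - r| < `|best - r| then x else best) x0 L in
  v \in x0 :: L /\ forall x, x \in x0 :: L -> `|v - r| <= `|x - r|.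
Proof.
elim: L => [|x L [vin vmin]] /=.
  by split=> [|x]; rewrite inE // => /eqP->.
set v := foldr _ _ _ in vin vmin *; case: ifP => [lt|/negbT]; last rewrite -leNgt => le.
  split=> [|z]; first by rewrite !inE eqxx orbT.
  rewrite !inE orbCA => /orP[/eqP->//|zin]; apply: le_trans (ltW lt) _.
  by apply: vmin; rewrite inE.
split=> [|z]; first by move: vin; rewrite !inE => /orP[->|->]; rewrite ?orbT.
by rewrite !inE orbCA => /orP[/eqP->//|zin]; apply: vmin; rewrite inE.
Qed.

Lemma closest_left_of C i r : (i < size C)%N -> srv C i <= r -> closest 0 i.+1 C r = srv C i.
Proof.
move=> iC ir; rewrite /closest /sub_conf drop0.
set L := take _ _.
have sL : size L = i.+1 by rewrite size_takel ?size_sort.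
have LE j : (j <= i)%N -> L`_j = srv C j by move=> ji; rewrite nth_take.
have [] := closest_fold r (head 0 L) L; set v := foldr _ _ _ => vin vmin.
have {}vin : v \in L.
  by move: vin; rewrite inE => /orP[/eqP->|//]; rewrite -nth0 mem_nth ?sL.
have [j] := nthP 0 vin; rewrite sL ltnS => ji vE.
have vi : v <= srv C i by rewrite -vE LE // srv_le.
have : `|v - r| <= `|srv C i - r|.
  by apply: vmin; rewrite inE -(LE i) // mem_nth ?orbT ?sL.
by move=> h; apply/eqP; rewrite eq_le vi /=; move: h; norm_lra.
Qed.

End Closest.

(** * The adversary *)

Section Adversary.
Context {R : realType}.
Variables (A : alg R) (mu : nat -> R) (B : seq R -> R) (K : R) (n : nat).
Hypothesis vA : valid_alg A.
Hypothesis mu_ge0 : forall m, 0 <= mu m.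
Hypothesis loc : forall (C0 : seq R) (s : seq (R * nat)) (j0 k' : nat),
  valid_preds (size C0) s -> (0 < k')%N -> (j0 + k' <= size C0)%N ->
  alg_cost_on j0 k' A C0 s <=
    mu k' * FtP (sub_conf j0 k' C0) (sub_inst j0 k' A C0 s)
    + Num.min (B C0) (K * k'%:R * dist C0 (alg_final A C0 s)).
Hypothesis n_gt0 : (0 < n)%N.
Implicit Types (C q Z p : seq R) (s t : seq (R * nat)) (i j : nat).

Let k := n.+1.

(* [run_bound1] bounds the cost of A on one excursion in which site 0 is not
   requested, [run_bound] on an arbitrary one.  Neither depends on the distance
   [gap] between the sites 1, ..., n, which can therefore be taken larger than any
   displacement of a server during an excursion. *)
Definition run_bound1 : R := mu k * (k%:R + 4) + `|K| * k%:R * (k%:R + 1).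
Definition run_bound : R :=
  run_bound1 + (mu k * (run_bound1 + k%:R + 5) + `|K| * k%:R * (run_bound1 + k%:R + 2)).
Let M := run_bound.
Definition gap : R := 2 * M + 6.
Definition site j : R := if j is j'.+1 then 1 + j'%:R * gap else 0.
Definition sites m := mkseq site m.
(** The offset 2 exceeds the tolerance of [near] by 1, so an excursion that returns to a [near]
    configuration costs at least 1. *)
Definition far : R := site n + 2.

Lemma run_bound1_ge0 : 0 <= run_bound1.
Proof. by rewrite /run_bound1 !(addr_ge0, mulr_ge0). Qed.

Lemma run_bound_ge : run_bound1 <= M.
Proof.
rewrite /M /run_bound lerDl.
by rewrite !(addr_ge0, mulr_ge0) // run_bound1_ge0.
Qed.

Lemma run_bound_ge0 : 0 <= M.
Proof. exact: le_trans run_bound1_ge0 run_bound_ge. Qed.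

Lemma site_gap i j : (0 < i)%N -> (i < j)%N -> site i + gap <= site j.
Proof.
case: i j => // i [//|j] _; rewrite ltnS /= => ij.
rewrite -addrA lerD2l -[X in _ + X <= _]mul1r -mulrDl.
have g0 : 0 <= gap by have := run_bound_ge0; rewrite /gap; lra.
by rewrite ler_wpM2r // natr1 ler_nat.
Qed.

Lemma site_lt i j : (i < j)%N -> site i + 1 <= site j.
Proof.
have M0 := run_bound_ge0.
case: i => [|i] ij; last by have := site_gap (ltn0Sn i) ij; rewrite /gap; lra.
case: j ij => // j _ /=; rewrite add0r lerDl mulr_ge0 //.
by rewrite /gap; lra.
Qed.

Lemma site_le i j : (i <= j)%N -> site i <= site j.
Proof.
by rewrite leq_eqVlt => /orP[/eqP->//|/site_lt]; lra.
Qed.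

Lemma sorted_sites m : sorted <=%R (sites m).
Proof.
apply/(sortedP 0) => j; rewrite size_mkseq => jm.
by rewrite !nth_mkseq ?(ltnW jm) // site_le.
Qed.

Lemma gapped_sites m : gapped (sites m).
Proof.
by move=> j; rewrite size_mkseq => jm; rewrite !nth_mkseq ?(ltnW jm) // site_lt.
Qed.

Lemma site_sites x : (x.2 < size (sites k))%N && (x.1 == (sites k)`_(x.2)) ->
  (x.2 <= n)%N /\ x.1 = site x.2.
Proof.
by rewrite size_mkseq => /andP[xk /eqP->]; rewrite nth_mkseq.
Qed.

(* Server 0 is sent back to site 0 only after it has been lured to site 1, which
   sits at coordinate 1. *)
Fixpoint legal C s : bool :=
  if s is x :: s' then ((x.2 == 0) ==> (srv C 0 == 1)) && legal (A C x.1 x.2) s'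
  else true.

Lemma legal_cat C s s' : legal C (s ++ s') = legal C s && legal (alg_final A C s) s'.
Proof. by elim: s C => //= x s IH C; rewrite IH andbA. Qed.

(** The state in which an excursion starts. Server 0 is left free: A may hold it anywhere to the
    left of site 1. *)
Definition near q :=
  [/\ size q = k, srv q 1 = 1 &
      forall j, (1 < j)%N -> (j <= n)%N -> `|srv q j - site j| <= 1].

(** Beyond the potential [dist q p], follow-the-prediction pays at most the round trip of server n
    between [p] and [far]. *)
Lemma cost_far_points q p s : size q = k -> size p = k -> gapped p -> on_points p s ->
  alg_cost A q ((far, n) :: s) <=
    mu k * (dist q p + 2 * `|far - p`_n|) + `|K| * k%:R * (dist q p + 1).
Proof.
move=> sq sp gp ps; rewrite -sq.
apply: (cost_le_ftp_potential vA mu_ge0 loc) => //; rewrite ?sq //.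
  by rewrite /valid_preds /= ltnSn -/(valid_preds _ _) -sp; apply: on_points_valid.
have srt := gapped_sorted gp.
have nq : (n < size (sort <=%R q))%N by rewrite size_sort sq.
have sZ : size (ftp_step (sort <=%R q) far n) = size p by rewrite size_ftp_step // size_sort sq.
have := ftp_on_points sZ srt ps.
have := ftp_step_potential far nq _ srt; rewrite size_sort sq => /(_ sp).
have -> : dist (sort <=%R q) p = dist q p.
  by rewrite /dist size_sort; apply: eq_bigr => i _; rewrite srv_sort.
rewrite /=; set a := dist _ _; set b := dist _ _; set c := alg_cost _ _ _; set d := dist _ _.
have := ler_distD p`_n (srv (sort <=%R q) n) far; rewrite (distrC p`_n far).
move: (dist q p) => e.
move: `|srv _ _ - far| `|srv _ _ - p`_n| `|far - _| => u v w; lra.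
Qed.

Lemma mono_bound (d d' c c' : R) : d <= d' -> c <= c' ->
  mu k * d + `|K| * k%:R * c <= mu k * d' + `|K| * k%:R * c'.
Proof.
by move=> dd cc; apply: lerD; apply: ler_wpM2l => //; rewrite mulr_ge0 ?ler0n.
Qed.

Lemma near_dist q p : near q -> size p = k -> sorted <=%R p ->
  (forall j, (0 < j)%N -> (j <= n)%N -> p`_j = site j) ->
  dist q p <= `|srv q 0 - p`_0| + n%:R.
Proof.
move=> [sq s1 sj] sp srt pj; rewrite /dist sq /k big_ord_recl /= (srv_sorted _ srt) lerD2l.
apply: le_trans (_ : \sum_(i < n) 1 <= _); last by rewrite sumr_const card_ord.
apply: ler_sum => i _; rewrite (srv_sorted _ srt) pj //.
case: (ltnP 1 (bump 0 i)) => h; first exact: sj.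
have -> : bump 0 i = 1%N by move: h; rewrite /bump /=; lia.
by rewrite s1 /= mul0r addr0 subrr normr0.
Qed.

Lemma cost_legal_no0 q s : near q -> on_points (sites k) s -> all (fun x => x.2 != 0%N) s ->
  alg_cost A q ((far, n) :: s) <= run_bound1.
Proof.
move=> nq ps s0; have [sq s1 _] := nq.
(* As site 0 is not requested, the resting point of server 0 may be chosen: its own position,
   lowered to 0 if necessary to keep a unit gap to site 1. This costs at most 1, however far left
   server 0 starts. *)
pose t0 := Num.min (srv q 0) 0.
have t00 : t0 <= 0 by rewrite /t0 ge_min lexx orbT.
pose p := t0 :: [seq site j.+1 | j <- iota 0 n].
have sp : size p = k by rewrite /= size_map size_iota.
have pE j : (j < n)%N -> p`_j.+1 = site j.+1.
  by move=> jn; rewrite /= (nth_map 0%N) ?size_iota // nth_iota.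
have gp : gapped p.
  move=> [|j]; rewrite sp ltnS => jn; last by rewrite !pE ?(ltnW jn) // site_lt.
  rewrite pE //=; lra.
have srt := gapped_sorted gp.
have pp : on_points p s.
  apply/allP => x xs; have x0 := allP s0 _ xs; have [xn ->] := site_sites (allP ps _ xs).
  rewrite sp ltnS xn /=; case: (x.2) x0 xn => // j _ jn.
  by rewrite pE.
have pn : p`_n = site n by case: (n) n_gt0 pE => // m _; apply.
apply: le_trans (cost_far_points sq sp gp pp) _.
have dq : dist q p <= k%:R.
  apply: le_trans (near_dist nq sp srt _) _.
    by case=> // j _ jn; rewrite pE.
  rewrite /k -natr1 addrC lerD2l /=.
  have : srv q 0 <= 1 by rewrite -s1 srv_le // sq.
  rewrite /t0; case: (leP (srv q 0) 0) => h; norm_lra.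
apply: mono_bound; last by rewrite lerD2r.
by rewrite pn /far [site n + _]addrC addrK ger0_norm //; lra.
Qed.

Lemma valid_far_points s : on_points (sites k) s -> valid_preds k ((far, n) :: s).
Proof.
by move=> ps; rewrite /valid_preds /= ltnSn; have := on_points_valid ps; rewrite size_mkseq.
Qed.

(** Before the first request to site 0 the cost is at most [run_bound1], and legality puts server 0
    at 1 at that moment. Hence server 0 started within [run_bound1 + 1] of site 0, and [sites k] can
    serve as resting points for the whole excursion. *)
Lemma cost_legal q s : near q -> on_points (sites k) s -> legal q ((far, n) :: s) ->
  alg_cost A q ((far, n) :: s) <= M.
Proof.
move=> nq ps ls; have [sq s1 _] := nq.
case h0 : (has (fun x => x.2 == 0%N) s); last first.
  apply: le_trans run_bound_ge; apply: cost_legal_no0 => //.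
  by apply/allP => x xs; move/negbT/hasPn: h0; apply.
have [s' [x [s'' [sE a1 x0]]]] := first_split h0.
have ps' : on_points (sites k) s' by move: ps; rewrite sE /on_points all_cat => /andP[].
have c1 : alg_cost A q ((far, n) :: s') <= run_bound1 by apply: cost_legal_no0.
have l0 : srv (alg_final A q ((far, n) :: s')) 0 = 1.
  move: ls; rewrite sE -cat_cons legal_cat => /andP[_] /=.
  by rewrite (eqP x0) /= => /andP[/eqP].
have q0 : `|srv q 0| <= run_bound1 + 1.
  have := @srv_final_le_cost _ A vA 0 q ((far, n) :: s').
  rewrite l0 sq => /(_ (ltn0Sn _) (valid_far_points ps')) h.
  have := le_trans h c1; norm_lra.
have ssz : size (sites k) = k by rewrite size_mkseq.
apply: le_trans (cost_far_points sq ssz (@gapped_sites k) ps) _.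
have dq : dist q (sites k) <= run_bound1 + k%:R + 1.
  apply: le_trans (near_dist nq ssz (sorted_sites _) _) _.
    by move=> j _ jn; rewrite nth_mkseq.
  rewrite nth_mkseq //= subr0 /k -[n.+1%:R]natr1; lra.
apply: le_trans (_ : mu k * (run_bound1 + k%:R + 5) + `|K| * k%:R * (run_bound1 + k%:R + 2) <= _).
  apply: mono_bound; last by lra.
  by rewrite nth_mkseq // /far [site n + _]addrC addrK ger0_norm //; lra.
by rewrite /M /run_bound lerDr run_bound1_ge0.
Qed.

(** [M + 1] is the tolerance 1 of [near] plus the bound [M] on the cost of an excursion. *)
Definition spread C :=
  size C = k /\ forall j, (0 < j)%N -> (j <= n)%N -> `|srv C j - site j| <= M + 1.

Lemma near_spread q : near q -> spread q.
Proof.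
have M0 := run_bound_ge0.
move=> [sq s1 sj]; split=> // j j0 jn.
case: (ltnP 1 j) => h; first by apply: le_trans (sj j h jn) _; lra.
have -> : j = 1%N by lia.
by rewrite s1 /= mul0r addr0 subrr normr0; lra.
Qed.

Lemma spread_final q s : near q -> on_points (sites k) s -> legal q ((far, n) :: s) ->
  spread (alg_final A q ((far, n) :: s)).
Proof.
move=> nq ps ls; have [sq s1 sj] := nq.
have vs := valid_far_points ps.
split; first by rewrite size_alg_final ?sq.
move=> j j0 jn; have := @srv_final_le_cost _ A vA j q ((far, n) :: s).
rewrite sq => /(_ jn vs) h; have {h} := le_trans h (cost_legal nq ps ls).
have : `|srv q j - site j| <= 1.
  case: (ltnP 1 j) => h; first exact: sj.
  have -> : j = 1%N by lia.
  by rewrite s1 /= mul0r addr0 subrr normr0.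
norm_lra.
Qed.

Fixpoint all_spread C s : Prop :=
  if s is x :: s' then spread (A C x.1 x.2) /\ all_spread (A C x.1 x.2) s' else True.

Lemma all_spread_cat C s s' :
  all_spread C s -> all_spread (alg_final A C s) s' -> all_spread C (s ++ s').
Proof. by elim: s C => //= x s IH C [h1 h2] h3; split=> //; apply: IH. Qed.

(** Every prefix of a legal excursion is itself one, so the cost bound holds at all times. *)
Lemma all_spread_legal q s : near q -> on_points (sites k) s -> legal q ((far, n) :: s) ->
  all_spread q ((far, n) :: s).
Proof.
move=> nq; elim/last_ind: s => [|s x IH] ps ls.
  by split=> //; apply: (spread_final nq ps ls).
have ps' : on_points (sites k) s by move: ps; rewrite -cats1 /on_points all_cat => /andP[].
have ls' : legal q ((far, n) :: s).
  by move: ls; rewrite -cats1 -cat_cons legal_cat => /andP[].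
have := spread_final nq ps ls.
rewrite -cats1 -cat_cons alg_final_cat => h.
by apply: all_spread_cat; [exact: IH | split].
Qed.

(** The gap keeps the neighbouring servers out of the window from site j to 2 beyond it, which for
    [j = n] contains [far]. Taking [1 < j] makes the left neighbour one that [spread] controls. *)
Lemma spread_serve C j : spread C -> (1 < j)%N -> (j <= n)%N -> forall r,
  site j <= r -> r <= site j + 2 -> r \in C -> srv C j = r.
Proof.
move=> [sC sj] j1 jn r jr rj rC; have [i] := mem_srv rC; rewrite sC ltnS => iin iE.
have M0 := run_bound_ge0.
case: (ltngtP i j) => [ij|ji|<-//].
  have h1 : srv C i <= srv C j.-1 by rewrite srv_le ?sC //; lia.
  have h2 := sj j.-1; have h3 := @site_gap j.-1 j.
  exfalso; suff : r < r by rewrite ltxx.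
  rewrite -{1}iE; apply: le_lt_trans h1 _; apply: lt_le_trans jr.
  have {}h2 : `|srv C j.-1 - site j.-1| <= M + 1 by apply: h2; lia.
  have {}h3 : site j.-1 + gap <= site j by apply: h3; lia.
  move: h3; rewrite /gap; norm_lra.
have h1 : srv C j.+1 <= srv C i by rewrite srv_le ?sC.
have h2 : `|srv C j.+1 - site j.+1| <= M + 1 by apply: sj => //; lia.
have h3 : site j + gap <= site j.+1 by apply: site_gap; lia.
exfalso; suff : r < r by rewrite ltxx.
rewrite -{2}iE; apply: lt_le_trans h1; apply: le_lt_trans rj _.
move: h3; rewrite /gap; norm_lra.
Qed.

Lemma spread_serve1 C : spread C -> 1 \in C -> srv C 1 = 1 \/ srv C 0 = 1.
Proof.
move=> [sC sj] rC; have [i] := mem_srv rC; rewrite sC ltnS => iin iE.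
case: i iin iE => [|[|i]] iin iE; [by right|by left|].
have M0 := run_bound_ge0.
have h2 : `|srv C i.+2 - site i.+2| <= M + 1 by apply: sj.
have h3 : site 1 + gap <= site i.+2 by apply: site_gap.
exfalso; suff : 1 < (1 : R) by rewrite ltxx.
rewrite -{2}iE; move: h3; rewrite /gap {1}/site mul0r; norm_lra.
Qed.

Lemma far_le_last C : size C = k -> far \in C -> far <= srv C n.
Proof.
by move=> sC rC; have [i] := mem_srv rC; rewrite sC ltnS => iin <-; rewrite srv_le ?sC.
Qed.

Lemma srv0_le C : (0 < size C)%N -> (0 : R) \in C -> srv C 0 <= 0.
Proof. by move=> C0 rC; have [i iC <-] := mem_srv rC; rewrite srv_le. Qed.

Lemma spread_closest C i m r : spread C -> (0 < i)%N -> (i < m)%N -> (m <= n)%N ->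
  site m <= r -> closest 0 i.+1 C r = srv C i.
Proof.
move=> [sC sj] i0 im mn mr; apply: closest_left_of; first by rewrite sC /k; lia.
have h2 : `|srv C i - site i| <= M + 1 by apply: sj => //; lia.
have := site_gap i0 im; have M0 := run_bound_ge0; rewrite /gap; norm_lra.
Qed.

(** * Follow-the-prediction on the prefix blocks *)

Definition request_ok (x : R * nat) := (x.2 <= n)%N /\ (x.1 = site x.2 \/ x = (far, n)).
Definition requests_ok s := forall x, x \in s -> request_ok x.

Lemma requests_ok_valid s : requests_ok s -> valid_preds k s.
Proof. by move=> h; apply/allP => x /h[]. Qed.

Lemma requests_ok_cat s t : requests_ok s -> requests_ok t -> requests_ok (s ++ t).
Proof. by move=> hs ht x; rewrite mem_cat => /orP[/hs|/ht]. Qed.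

Lemma requests_ok_points s : on_points (sites k) s -> requests_ok s.
Proof. by move=> ps x /(allP ps)/site_sites[xn xE]; split=> //; left. Qed.

(** Where follow-the-prediction should stand on the block 0, ..., i: on the sites, except that its
    last server copies server i of A. *)
Definition target i C := rcons (sites i) (srv C i).

Lemma size_target i C : size (target i C) = i.+1.
Proof. by rewrite size_rcons size_mkseq. Qed.

Lemma target_last i C : (target i C)`_i = srv C i.
Proof. by rewrite nth_rcons size_mkseq ltnn eqxx. Qed.

Lemma target_site i j C : (j < i)%N -> (target i C)`_j = site j.
Proof. by move=> ji; rewrite nth_rcons size_mkseq ji nth_mkseq. Qed.

Lemma sorted_target i C : spread C -> (1 < i)%N -> (i <= n)%N -> sorted <=%R (target i C).
Proof.
move=> [sC sj] i1 iin; apply/(sortedP 0) => j; rewrite size_target ltnS => ji.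
rewrite target_site //; case: (ltnP j.+1 i) => h; first by rewrite target_site // site_le.
have {ji h} ij : i = j.+1 by apply/eqP; rewrite eqn_leq h ji.
rewrite -ij target_last.
have h2 : `|srv C i - site i| <= M + 1 by apply: sj => //; lia.
have h3 : site j + gap <= site i by apply: site_gap; lia.
have M0 := run_bound_ge0; move: h3; rewrite /gap; norm_lra.
Qed.

Definition sub_request i C (x : R * nat) :=
  if (x.2 <= i)%N then x else (closest 0 i.+1 C x.1, i).

Lemma sub_inst_cons i C x s :
  sub_inst 0 i.+1 A C (x :: s) =
  sub_request i (A C x.1 x.2) x :: sub_inst 0 i.+1 A (A C x.1 x.2) s.
Proof.
rewrite /= /sub_request add0n ltnS subn0.
by case: ifP => // _; rewrite -surjective_pairing.
Qed.

Lemma sub_request_le i C x : ((sub_request i C x).2 <= i)%N.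
Proof. by rewrite /sub_request; case: ifP. Qed.

Lemma size_ftp_sub_inst i C s Z : size Z = i.+1 ->
  size (alg_final (@ftp_step R) Z (sub_inst 0 i.+1 A C s)) = i.+1.
Proof.
elim: s C Z => // x s IH C Z sZ; rewrite sub_inst_cons /=; apply: IH.
by rewrite size_ftp_step sZ // ltnS sub_request_le.
Qed.

(* From server 2 on, every request of the restricted instance coincides with the
   current target, so that follow-the-prediction tracks the last server. *)
Lemma sub_request_target i C x : spread C -> (1 < i)%N -> (i <= n)%N -> request_ok x ->
  x.1 \in C -> let z := sub_request i C x in z.1 = (target i C)`_(z.2).
Proof.
move=> sC i1 iin [xn xs] xC; rewrite /= /sub_request.
have sx : site x.2 <= x.1 by case: xs => ->; rewrite //= /far; lra.
have sx2 : x.1 <= site x.2 + 2 by case: xs => ->; rewrite //= /far; lra.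
case: ltngtP => [xi|xi|xi] /=.
- rewrite target_site //; case: xs => // xE; move: xi; rewrite xE /=; lia.
- by rewrite target_last (spread_closest sC (ltnW i1) xi xn sx).
- by rewrite xi target_last -xi (spread_serve sC _ _ sx sx2) // xi.
Qed.

(** The potential is the distance to the moving target. A step of A raises it by at most the move of
    server i, and each restricted request, lying on the target, is paid from it. *)
Lemma ftp_track i C s Z : (1 < i)%N -> (i <= n)%N -> spread C -> all_spread C s ->
  requests_ok s -> size Z = i.+1 ->
  alg_cost (@ftp_step R) Z (sub_inst 0 i.+1 A C s)
    + dist (alg_final (@ftp_step R) Z (sub_inst 0 i.+1 A C s)) (target i (alg_final A C s))
  <= dist Z (target i C) + srv_path A i C s.
Proof.
move=> i1 iin; elim: s C Z => [|x s IH] C Z sC aC rs sZ; first by rewrite /= addr0 add0r.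
rewrite sub_inst_cons [alg_final A C _]/= [srv_path _ _ _ _]/=; move: aC => /= [sC' aC'].
have rx : request_ok x by apply: rs; rewrite inE eqxx.
have rs' : requests_ok s by move=> z zs; apply: rs; rewrite inE zs orbT.
have [xn _] := rx; have [sC0 _] := sC.
have [_ xC'] : size (A C x.1 x.2) = size C /\ x.1 \in A C x.1 x.2 by apply: vA; rewrite sC0.
set C' := A C x.1 x.2 in sC' aC' xC' *; set z := sub_request i C' x.
have zi : (z.2 < size Z)%N by rewrite sZ ltnS sub_request_le.
have zE : z.1 = (target i C')`_(z.2) by exact: sub_request_target.
have := IH C' (ftp_step Z z.1 z.2) sC' aC' rs'.
rewrite size_ftp_step // => /(_ sZ).
have := ftp_step_potential z.1 zi _ (sorted_target sC' i1 iin).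
rewrite size_target => /(_ (esym sZ)); rewrite -zE subrr normr0.
have : dist Z (target i C') <= dist Z (target i C) + `|srv C i - srv C' i|.
  rewrite /dist sZ !big_ord_recr /=.
  rewrite !(srv_sorted _ (sorted_target sC' i1 iin)) !(srv_sorted _ (sorted_target sC i1 iin)).
  rewrite !target_last -addrA; apply: lerD; last exact: ler_distD.
  apply: ler_sum => j _.
  rewrite (srv_sorted _ (sorted_target sC' i1 iin)) (srv_sorted _ (sorted_target sC i1 iin)).
  by rewrite !target_site.
lra.
Qed.

(** For the block 0, 1 the moving target fails, since server 0 may answer site 1. The potential
    refers to the fixed sites instead and is compared only at chosen moments; the quantifier over
    [Z] makes the property composable. *)
Definition track1 C s := forall Z, size Z = 2 ->
  alg_cost (@ftp_step R) Z (sub_inst 0 2 A C s)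
    + dist (alg_final (@ftp_step R) Z (sub_inst 0 2 A C s)) (sites 2)
  <= dist Z (sites 2) + srv_path A 1 C s.

Lemma track1_cat C s t : track1 C s -> track1 (alg_final A C s) t -> track1 C (s ++ t).
Proof.
move=> h1 h2 Z sZ; rewrite sub_inst_cat alg_cost_cat alg_final_cat srv_path_cat.
have := h1 Z sZ; have := h2 _ (size_ftp_sub_inst C s sZ); lra.
Qed.

(* Server 1 returns to site 1 before the next request predicted for a server
   further right, so it travels at least as far as the tracking server. *)
Lemma track1_macro C x s : srv C 1 = 1 -> size C = k -> request_ok x -> (1 <= x.2)%N ->
  (1 < x.2)%N \/ x = (far, n) ->
  spread (A C x.1 x.2) -> on_points (sites k) s -> all (fun z => z.2 <= 1)%N s ->
  srv (alg_final A C (x :: s)) 1 = 1 -> track1 C (x :: s).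
Proof.
move=> s1 sC rx x1 xfar sC' ps s01 f1 Z sZ; rewrite sub_inst_cons.
have [xn xs] := rx; have [sC0 _] := sC'.
have [_ xC'] : size (A C x.1 x.2) = size C /\ x.1 \in A C x.1 x.2 by apply: vA; rewrite sC.
rewrite /= in f1 *.
set C' := A C x.1 x.2 in f1 sC' sC0 xC' *; set z := sub_request 1 C' x.
have -> : sub_inst 0 2 A C' s = s by apply: sub_inst_full.
have ps2 : on_points (sites 2) s.
  apply/allP => w ws; have := allP s01 _ ws; have [_ ->] := site_sites (allP ps _ ws).
  by rewrite size_mkseq => w1; rewrite ltnS w1 nth_mkseq /=.
have z2 : z.2 = 1%N by rewrite /z /sub_request; case: ifP => //= ?; lia.
(* A prediction beyond server 1 is replaced by a request at server 1 itself. Otherwise n is 1 and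
   the request is [far], which server 1 has reached or passed. *)
have zb : `|z.1 - 1| <= `|srv C' 1 - 1|.
  rewrite /z /sub_request; case: ifP => /= [xle|/negbT]; last first.
    rewrite -ltnNge => xgt.
    rewrite (spread_closest sC' _ xgt) //.
    by case: xs => ->; rewrite //= /far; lra.
  case: xfar => [|xE]; first by lia.
  have : far <= srv C' n by apply: far_le_last; rewrite // -[far]/((far, n).1) -xE.
  have n1 : n = 1%N by move: xle; rewrite xE /=; lia.
  by rewrite xE /= /far n1 /= mul0r; norm_lra.
have zZ : (z.2 < size Z)%N by rewrite z2 sZ.
have sZ' : size (ftp_step Z z.1 z.2) = size (sites 2) by rewrite size_ftp_step // size_mkseq.
have := ftp_on_points sZ' (sorted_sites 2) ps2.
have := ftp_step_potential z.1 zZ _ (sorted_sites 2).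
rewrite size_mkseq => /(_ (esym sZ)).
have p1 : (sites 2)`_1 = 1 by rewrite nth_mkseq //= mul0r addr0.
rewrite z2 p1.
have := ler_distD 1 (srv Z 1) z.1; rewrite (distrC 1 z.1).
have := srv_path_ge A 1 C' s; rewrite f1 s1 (distrC 1).
move: zb; lra.
Qed.

Lemma site1 : site 1 = 1. Proof. by rewrite /site mul0r addr0. Qed.

(** The positive part of the position of server 0 is a potential: a request to site 0 forces a
    descent of at least 1 and lowers it from 1 to 0, which accounts for 2; any other step changes it
    by at most the distance moved. *)
Lemma legal_path0 C s : size C = k -> requests_ok s -> legal C s ->
  2 * (count (fun x => x.2 == 0%N) s)%:R + Num.max 0 (srv (alg_final A C s) 0)
  <= srv_path A 0 C s + Num.max 0 (srv C 0).
Proof.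
elim: s C => [|x s IH] C sC rs /=; first by rewrite mulr0.
move=> /andP[lx ls].
have rs' : requests_ok s by move=> z zs; apply: rs; rewrite inE zs orbT.
have [xn xs] : request_ok x by apply: rs; rewrite inE eqxx.
have [sC' xC'] : size (A C x.1 x.2) = size C /\ x.1 \in A C x.1 x.2 by apply: vA; rewrite sC.
have := IH _ (etrans sC' sC) rs' ls.
set C' := A C x.1 x.2 in sC' xC' *; rewrite natrD.
set m0 := Num.max 0 _; set p := srv_path _ _ _ _; set c := (count _ _)%:R.
case x0 : (x.2 == 0%N) lx => /=; last first.
  move=> _; rewrite add0r.
  case: (leP 0 (srv C 0)) => h; case: (leP 0 (srv C' 0)) => h'; norm_lra.
move=> /eqP sC1.
have x10 : x.1 = 0.
  case: xs => [->|xE]; first by rewrite (eqP x0).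
  by move: x0 n_gt0; rewrite xE /= => /eqP->.
have : srv C' 0 <= 0 by apply: srv0_le; rewrite ?sC' ?sC // -x10.
by rewrite sC1; case: (leP 0 1) => // h; case: (leP 0 (srv C' 0)) => h'; norm_lra.
Qed.

(** * Construction of the request sequence *)

Let fin q s := alg_final A q ((far, n) :: s).

Lemma fin_cat q s t : fin q (s ++ t) = alg_final A (fin q s) t.
Proof. by rewrite /fin -cat_cons alg_final_cat. Qed.

Lemma points_cat s t : on_points (sites k) s -> on_points (sites k) t ->
  on_points (sites k) (s ++ t).
Proof. by rewrite /on_points all_cat => -> ->. Qed.

Lemma points1 j : (j <= n)%N -> on_points (sites k) [:: (site j, j)].
Proof.
move=> jn; rewrite /on_points all_seq1; apply/andP; split; first by rewrite size_mkseq.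
by rewrite nth_mkseq.
Qed.

(* Site 1 is requested until server 1 sits there; whenever server 0 answers
   instead, it is first sent back to site 0. *)
Lemma restore1 q s : near q -> on_points (sites k) s -> legal q ((far, n) :: s) ->
  exists t, [/\ on_points (sites k) t, all (fun z => z.2 <= 1)%N t,
    legal q ((far, n) :: s ++ t) & srv (fin q (s ++ t)) 1 = 1].
Proof.
move=> nq; have [sq _ _] := nq.
(* [m] counts the attempts still affordable: a failed attempt drags server 0 from 1 to site 0 or
   beyond, which costs at least 1, while the whole excursion costs at most [M]. *)
suff H m : forall s, on_points (sites k) s -> legal q ((far, n) :: s) ->
    M < alg_cost A q ((far, n) :: s) + m%:R ->
    exists t, [/\ on_points (sites k) t, all (fun z => z.2 <= 1)%N t,
      legal q ((far, n) :: s ++ t) & srv (fin q (s ++ t)) 1 = 1].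
  move=> ps ls; apply: (H (Num.bound M) s ps ls).
  apply: lt_le_trans (archi_boundP run_bound_ge0) _.
  by rewrite lerDr alg_cost_ge0.
elim: m => [|m IH] {}s ps ls.
  by rewrite addr0 ltNge (cost_legal nq ps ls).
move=> hm.
have [sC _] : spread (fin q s) by exact: spread_final.
have l1 : legal q ((far, n) :: s ++ [:: (site 1, 1%N)]).
  by move: ls; rewrite -cat_cons legal_cat => ->.
have p1 := points_cat ps (points1 n_gt0).
have sp1 := spread_final nq p1 l1; rewrite -/(fin _ _) in sp1.
have in1 : 1 \in fin q (s ++ [:: (site 1, 1%N)]).
  rewrite fin_cat /= -[X in X \in _]site1.
  have [||_] // := @vA (fin q s) (site 1) 1; rewrite sC //.
have [e1|e0] := spread_serve1 sp1 in1.
  by exists [:: (site 1, 1%N)]; split=> //; exact: points1.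
set s1 := s ++ [:: (site 1, 1%N)] in l1 p1 sp1 in1 e0.
have l2 : legal q ((far, n) :: s1 ++ [:: (site 0, 0%N)]).
  by move: l1; rewrite -cat_cons legal_cat => -> /=; rewrite -/(fin q s1) e0 eqxx.
have p2 := points_cat p1 (points1 (leq0n n)).
have [sC1 _] := sp1.
have [sC2 in2] : size (A (fin q s1) 0 0) = size (fin q s1) /\ 0 \in A (fin q s1) 0 0.
  by apply: vA; rewrite sC1.
have c2 : alg_cost A q ((far, n) :: s) + 1 <= alg_cost A q ((far, n) :: s1 ++ [:: (site 0, 0%N)]).
  rewrite -cat_cons (alg_cost_cat _ _ ((far, n) :: s1)) -/(fin q s1); apply: lerD; last first.
    have h0 : srv (A (fin q s1) 0 0) 0 <= 0 by apply: srv0_le; rewrite // sC2 sC1.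
    have := @srv_dist_le _ (fin q s1) (A (fin q s1) 0 0) 0; rewrite sC1 e0 => /(_ isT).
    by rewrite /= addr0; apply: le_trans; norm_lra.
  by rewrite /s1 -cat_cons (alg_cost_cat _ _ ((far, n) :: s)) lerDl alg_cost_ge0.
have [|t [pt t1 lt ft]] := IH _ p2 l2.
  by move: hm c2; rewrite -[m.+1%:R]natr1; lra.
exists ([:: (site 1, 1%N); (site 0, 0%N)] ++ t).
move: lt ft; rewrite /s1 -!catA /= => lt ft; split=> //.
exact: (points_cat (points1 n_gt0) (points_cat (points1 (leq0n n)) pt)).
Qed.

Definition run_inv q s :=
  [/\ on_points (sites k) s, legal q ((far, n) :: s), srv (fin q s) 1 = 1 &
      track1 q ((far, n) :: s)].

Lemma run_inv_start q : near q -> exists s, run_inv q s.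
Proof.
move=> nq; have [sq s1 _] := nq.
have l0 : legal q [:: (far, n)] by rewrite /= andbT; case: (n) n_gt0.
have [t [pt t1 lt ft]] := @restore1 q [::] nq isT l0.
exists t; split=> //; apply: (track1_macro s1 sq) => //.
- by split=> //; right.
- by right.
- exact: (@spread_final q [::]).
Qed.

(** Server j itself answers site j, so its later drift is bounded by the cost of the requests that
    bring server 1 back. *)
Lemma run_inv_step q s j : near q -> run_inv q s -> (1 < j)%N -> (j <= n)%N ->
  exists t, run_inv q (s ++ t) /\
    `|srv (fin q (s ++ t)) j - site j| <= alg_cost A (fin q s) t.
Proof.
move=> nq [ps ls fs ts] j1 jn; set x := (site j, j).
have lx : legal q ((far, n) :: s ++ [:: x]).
  by move: ls; rewrite -cat_cons legal_cat => -> /=; case: (j) j1.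
have px := points_cat ps (points1 jn).
have [t [pt t1 lt ft]] := restore1 nq px lx.
rewrite -catA /= in lt ft.
have sx := spread_final nq px lx; rewrite -/(fin _ _) fin_cat /= in sx.
have [sC _] : spread (fin q s) by exact: spread_final.
have vt : valid_preds k t by have := on_points_valid pt; rewrite size_mkseq.
have [sC' xC'] : size (A (fin q s) (site j) j) = size (fin q s) /\ site j \in A (fin q s) (site j) j.
  by apply: vA; rewrite sC.
have sj : srv (A (fin q s) (site j) j) j = site j.
  by apply: (spread_serve sx) => //; rewrite lerDl.
exists (x :: t); split; last first.
  rewrite fin_cat /= -[X in _ - X]sj distrC.
  apply: le_trans (_ : alg_cost A (A (fin q s) (site j) j) t <= _); last by rewrite lerDr dist_ge0.
  by apply: srv_final_le_cost; rewrite // sC' sC.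
split=> //; first by rewrite -cat1s catA; apply: points_cat.
rewrite -cat_cons; apply: track1_cat => //.
apply: (track1_macro fs sC) => //; rewrite -/(fin q s).
- by split=> //; left.
- exact: ltnW.
- by left.
- by move: ft; rewrite fin_cat.
Qed.

Lemma run_inv_round q s js : near q -> run_inv q s ->
  all (fun j => (1 < j <= n)%N) js ->
  exists t, run_inv q (s ++ t) /\
    forall j, j \in js -> `|srv (fin q (s ++ t)) j - site j| <= alg_cost A (fin q s) t.
Proof.
move=> nq; elim: js s => [|j js IH] s iv /=; first by exists [::]; rewrite cats0.
move=> /andP[/andP[j1 jn] hjs].
have [t1 [iv1 h1]] := run_inv_step nq iv j1 jn.
have [t2 [iv2 h2]] := IH _ iv1 hjs.
exists (t1 ++ t2); rewrite catA; split=> // i; rewrite alg_cost_cat -fin_cat inE.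
case/orP=> [/eqP->|ijs]; last first.
  by apply: le_trans (h2 i ijs) _; rewrite lerDr alg_cost_ge0.
have [p2 _ _ _] := iv2; have [p1 l1 _ _] := iv1.
have vt2 : valid_preds k t2.
  have : on_points (sites k) t2 by move: p2; rewrite /on_points all_cat => /andP[].
  by move/on_points_valid; rewrite size_mkseq.
have [sC _] : spread (fin q (s ++ t1)) by exact: spread_final.
have := @srv_final_le_cost _ A vA j (fin q (s ++ t1)) t2.
rewrite sC ltnS -fin_cat => /(_ jn vt2).
move: h1; norm_lra.
Qed.

(** Rounds over the sites 2, ..., n are repeated. Those costing at least 1 exhaust the bound [M];
    after a cheaper one every server from 2 on has drifted by less than 1. *)
Lemma run_inv_near q : near q -> exists s, run_inv q s /\ near (fin q s).
Proof.
move=> nq.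
suff H m : forall s, run_inv q s -> M < alg_cost A q ((far, n) :: s) + m%:R ->
    exists s, run_inv q s /\ near (fin q s).
  have [s iv] := run_inv_start nq; apply: (H (Num.bound M) s iv).
  apply: lt_le_trans (archi_boundP run_bound_ge0) _.
  by rewrite lerDr alg_cost_ge0.
elim: m => [|m IH] s iv hm.
  by have [ps ls _ _] := iv; move: hm; rewrite addr0 ltNge (cost_legal nq ps ls).
have [|t [iv' h]] := run_inv_round nq iv (js := iota 2 n.-1).
  by apply/allP => j; rewrite mem_iota; lia.
case: (leP 1 (alg_cost A (fin q s) t)) => ct.
  apply: (IH _ iv'); move: hm; rewrite -cat_cons alg_cost_cat -/(fin q s) -[m.+1%:R]natr1; lra.
exists (s ++ t); split=> //; have [ps ls fs _] := iv'.
have [sC _] : spread (fin q (s ++ t)) by exact: spread_final.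
split=> // j j1 jn; apply: le_trans (h j _) (ltW ct).
by rewrite mem_iota; lia.
Qed.

Definition good C s :=
  [/\ requests_ok s, legal C s, all_spread C s & track1 C s].

Lemma good_cat C s t : good C s -> good (alg_final A C s) t -> good C (s ++ t).
Proof.
move=> [r1 l1 a1 t1] [r2 l2 a2 t2]; split.
- exact: requests_ok_cat.
- by rewrite legal_cat l1.
- exact: all_spread_cat.
- exact: track1_cat.
Qed.

Lemma good_cycle q : near q ->
  exists s, [/\ good q s, near (alg_final A q s) & 1 <= alg_cost A q s].
Proof.
move=> nq; have [s [[ps ls fs ts] nf]] := run_inv_near nq.
have [sq _ _] := nq; exists ((far, n) :: s); split=> //.
  split=> //; last exact: all_spread_legal.
  by move=> x; rewrite inE => /orP[/eqP->|/(requests_ok_points ps)//]; split=> //; right.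
have [sC' xC'] : size (A q far n) = size q /\ far \in A q far n by apply: vA; rewrite sq.
have hf : far <= srv (A q far n) n by apply: far_le_last; rewrite ?sC'.
have hn : srv (fin q s) n <= site n + 1.
  have [_ f1 fj] := nf; case: (ltnP 1 n) => h.
    by have := fj n h (leqnn n); norm_lra.
  have n1 : n = 1%N by lia.
  have e m : m = 1%N -> srv (fin q s) m = 1 by move=> ->.
  by rewrite (e n n1) n1 site1 lerDl.
rewrite /=; apply: le_trans (_ : alg_cost A (A q far n) s <= _); last by rewrite lerDr dist_ge0.
have vs : valid_preds k s by have := on_points_valid ps; rewrite size_mkseq.
have := @srv_final_le_cost _ A vA n (A q far n) s; rewrite sC' sq => /(_ (ltnSn n) vs).
apply: le_trans; move: hn hf; rewrite /fin /= /far; norm_lra.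
Qed.

Lemma near_sites : near (sites k).
Proof.
have srvE j : (j <= n)%N -> srv (sites k) j = site j.
  by move=> jn; rewrite srv_sorted ?sorted_sites // nth_mkseq.
split; [by rewrite size_mkseq|by rewrite srvE // site1|].
by move=> j _ jn; rewrite srvE // subrr normr0.
Qed.

Lemma good_run (N : nat) : exists s, good (sites k) s /\ N%:R <= alg_cost A (sites k) s.
Proof.
suff [s [gs _ cs]] : exists s, [/\ good (sites k) s, near (alg_final A (sites k) s) &
    N%:R <= alg_cost A (sites k) s] by exists s.
elim: N => [|N [s [gs nf cs]]].
  exists [::]; split=> //; last exact: near_sites.
  by split=> // Z sZ; rewrite /= addr0 add0r.
have [t [gt nt ct]] := good_cycle nf.
exists (s ++ t); rewrite alg_final_cat alg_cost_cat; split=> //; first exact: good_cat.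
by rewrite -natr1 lerD.
Qed.

(** * The offline schedule *)

Definition parked (r : R) : seq R :=
  (if r == 0 then 0 else 1) :: rcons [seq site j | j <- iota 2 n.-1] far.

Lemma size_parked r : size (parked r) = k.
Proof. by rewrite /parked /= size_rcons size_map size_iota prednK. Qed.

Lemma dist_parked r r' : dist (parked r) (parked r') <= (((r == 0) != (r' == 0)) : nat)%:R.
Proof.
apply: le_trans (dist_le_pairing _) _; first by rewrite !size_parked.
rewrite [size _]/= big_ord_recl /= big1 ?addr0; last by move=> i _; rewrite subrr normr0.
by rewrite /parked; case: (r == 0); case: (r' == 0) => /=;
  rewrite ?subrr ?subr0 ?sub0r ?normrN ?normr1 ?normr0.
Qed.

Lemma request_parked x : request_ok x ->
  (x.1 == 0) = (x.2 == 0%N) /\ x.1 \in parked x.1.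
Proof.
move=> [xn xs].
have s1 j : (0 < j)%N -> (site j == 0) = false.
  by move=> j0; apply/negP => /eqP e; have := site_lt j0; rewrite e add0r ler10.
case: xs => [e|->]; last first.
  have -> : (far == 0) = false.
    by apply/negP => /eqP e; have := site_lt n_gt0; move: e; rewrite /far add0r => e; lra.
  split; last by rewrite /parked in_cons mem_rcons mem_head orbT.
  by move: n_gt0; rewrite lt0n => /negbTE ->.
rewrite e; case: (x.2) xn => [|[|j]] jn; split; rewrite ?[site _.+1 == 0]s1 ?eqxx //.
- by rewrite /parked in_cons eqxx [site 0]/= eqxx.
- by rewrite /parked s1 // site1 in_cons eqxx.
rewrite /parked in_cons mem_rcons in_cons; apply/orP; right; apply/orP; right.
by apply/map_f; rewrite mem_iota; lia.
Qed.

(* Offline, the servers stay on all sites but site 0, and only the leftmost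
   server makes round trips to site 0. *)
Lemma OPT_le C s : size C = k -> requests_ok s ->
  OPT C (map fst s) <= dist C (parked 1) + 2 * (count (fun x => x.2 == 0%N) s)%:R.
Proof.
move=> sC rs; apply: le_trans (OPT_le_sched (_ : sched_ok _ _ [seq parked x.1 | x <- s])) _.
  elim: s C sC rs => //= x s IH C sC rs.
  have /request_parked[_ xin] : request_ok x by apply: rs; rewrite inE eqxx.
  rewrite sC -[X in X == _]/(size (parked x.1)) size_parked eqxx xin IH ?size_parked // => z zs.
  by apply: rs; rewrite inE zs orbT.
elim: s C sC rs => [|x s IH] C sC rs /=; first by rewrite mulr0 addr0 dist_ge0.
have /request_parked[x0 _] : request_ok x by apply: rs; rewrite inE eqxx.
have := IH (parked x.1) (size_parked _) _.
have rs' : requests_ok s by move=> z zs; apply: rs; rewrite inE zs orbT.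
move=> /(_ rs'); rewrite natrD -x0.
have := @dist_triangle _ C (parked 1) (parked x.1); rewrite size_parked => /(_ sC).
have := dist_parked 1 x.1; have := dist_parked x.1 1; rewrite oner_eq0.
by case: (x.1 == 0) => /=; lra.
Qed.

Lemma sub_conf_sites i : (i <= n)%N -> sub_conf 0 i.+1 (sites k) = sites i.+1.
Proof.
move=> iin; rewrite /sub_conf drop0 sort_le_id ?sorted_sites // /sites /mkseq -map_take.
by rewrite take_iota; congr (map _ (iota _ _)); apply/minn_idPl.
Qed.

(** Follow-the-prediction starts on its target, so the initial potential vanishes. The additive term
    is [B] at a fixed configuration, hence independent of the length of the run. *)
Lemma prefix_block i s : (0 < i)%N -> (i <= n)%N -> good (sites k) s ->
  \sum_(j < i.+1) srv_path A j (sites k) s <=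
    mu i.+1 * srv_path A i (sites k) s + B (sites k).
Proof.
move=> i0 iin [rs ls as_ ts].
have sk : size (sites k) = k by rewrite size_mkseq.
have vs : valid_preds (size (sites k)) s by rewrite sk; exact: requests_ok_valid.
have := @loc (sites k) s 0 i.+1 vs isT; rewrite sk => /(_ iin).
rewrite alg_cost_onE => /le_trans; apply; apply: lerD; last by rewrite ge_min lexx.
apply: ler_wpM2l => //; rewrite sub_conf_sites //.
have dd m : dist (sites m) (sites m) = 0.
  by rewrite /dist big1 // => j _; rewrite subrr normr0.
have tE : target i (sites k) = sites i.+1.
  rewrite /target srv_sorted ?sorted_sites // nth_mkseq // /sites /mkseq -addn1 iotaD map_cat.
  by rewrite add0n cats1.
case: (ltnP 1 i) => i1.
  have := @ftp_track i (sites k) s (sites i.+1) i1 iin (near_spread near_sites) as_ rs.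
  rewrite size_mkseq => /(_ erefl).
  rewrite tE dd add0r; apply: le_trans.
  by rewrite lerDl dist_ge0.
have e1 : i = 1%N by lia.
rewrite e1; have := ts (sites 2) (size_mkseq _ _); rewrite dd add0r; apply: le_trans.
by rewrite lerDl dist_ge0.
Qed.

Lemma path0_ge s : good (sites k) s ->
  2 * (count (fun x => x.2 == 0%N) s)%:R <= srv_path A 0 (sites k) s.
Proof.
move=> [rs ls _ _]; have := legal_path0 (size_mkseq _ _) rs ls.
rewrite (srv_sorted _ (sorted_sites k)) nth_mkseq //= maxxx addr0; apply: le_trans.
by rewrite lerDl le_max lexx.
Qed.

End Adversary.

(** * From block costs to the competitive ratio *)

Section Rates.
Context {R : realType}.
Variable lam : R.
Hypothesis lam01 : 0 < lam <= 1.

Lemma rhoS m : rho lam m.+1 = 1 + lam * rho lam m.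
Proof.
rewrite /rho big_ord_recl expr0 mulr_sumr; congr (_ + _).
by apply: eq_bigr => i _; rewrite /= /bump /= add1n exprS.
Qed.

Lemma rho_ge0 m : 0 <= rho lam m.
Proof.
by apply: sumr_ge0 => i _; apply: exprn_ge0; case/andP: lam01 => /ltW.
Qed.

Lemma rho_ge1 m : 1 <= rho lam m.+1.
Proof. by rewrite rhoS lerDl mulr_ge0 ?rho_ge0 //; case/andP: lam01 => /ltW. Qed.

Lemma beta_rho m : lam ^+ m * beta lam m.+1 = rho lam m.+1.
Proof.
have l0 : lam != 0 by case/andP: lam01 => /lt0r_neq0.
rewrite /beta mulr_sumr /rho (reindex_inj rev_ord_inj); apply: eq_bigr => i _ /=.
have im : (i <= m)%N by rewrite -ltnS.
by rewrite subSS -{1}(subnKC im) exprD mulfK // expf_neq0.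
Qed.

Lemma beta_gt0 m : 0 < beta lam m.+1.
Proof.
have lm : 0 < lam ^+ m by apply: exprn_gt0; case/andP: lam01.
by rewrite -(pmulr_rgt0 _ lm) beta_rho (lt_le_trans ltr01) ?rho_ge1.
Qed.

Fixpoint rate_loss (b : R) (i : nat) : R :=
  if i is j.+1 then rho lam i.+1 * rate_loss b j + b else 0.

Lemma rate_loss_ge0 b i : 0 <= b -> 0 <= rate_loss b i.
Proof. by move=> b0; elim: i => //= i IH; rewrite addr_ge0 // mulr_ge0 ?rho_ge0. Qed.

(** With P the sum up to server i, the next inequality reads [P <= lam * rho lam i.+1 * T i.+1 + b].
    Up to additive loss, adding [T i.+1] thus multiplies P by at least
    [rho lam i.+2 / (lam * rho lam i.+1)], and these factors telescope. *)
Lemma rate_chain (b : R) (T : nat -> R) (n : nat) : 0 <= b -> (forall j, 0 <= T j) ->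
  (forall i, (0 < i)%N -> (i <= n)%N -> \sum_(j < i.+1) T j <= rho lam i.+1 * T i + b) ->
  forall i, (i <= n)%N -> rho lam i.+1 * T 0 - rate_loss b i <= lam ^+ i * \sum_(j < i.+1) T j.
Proof.
move=> b0 T0 H; elim=> [|i IH] iin.
  by rewrite expr0 mul1r rhoS /rho big_ord0 mulr0 addr0 mul1r subr0 big_ord1.
have := H i.+1 isT iin; have := IH (ltnW iin).
rewrite [\sum_(j < i.+2) T j]big_ord_recr /=.
set P := \sum_(j < i.+1) T j; rewrite [rho _ i.+2]rhoS.
have P0 : 0 <= P by apply: sumr_ge0.
have := rate_loss_ge0 i b0; have := rho_ge1 i; have := T0 i.+1; have := T0 0%N.
move: (rho lam i.+1) (T i.+1) (T 0) (rate_loss b i) => r t t0 d ht0 ht hr hd h1 h2.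
have [l0 l1] := andP lam01.
have a1 : lam ^+ i <= 1 by apply: exprn_ile1 => //; apply: ltW.
have a0 : 0 <= lam ^+ i by apply: exprn_ge0; apply: ltW.
rewrite exprS; move: (lam ^+ i) a0 a1 h1 => a a0 a1 h1.
have r0 : 0 < r by apply: lt_le_trans hr.
(* After multiplication by [r], the difference of the two sides is exactly the sum of the
   expressions in [e1] to [e4]. *)
rewrite -(ler_pM2l r0).
have e1 : 0 <= a * (lam * r * t + b - P) by apply: mulr_ge0 => //; lra.
have e2 : 0 <= (1 + lam * r) * (a * P - (r * t0 - d)).
  by apply: mulr_ge0; [rewrite addr_ge0 // mulr_ge0 // ltW | lra].
have e3 : 0 <= (1 - a) * b by apply: mulr_ge0 => //; lra.
have e4 : 0 <= (r - 1) * ((1 + lam * r) * d + b).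
  apply: mulr_ge0; first by lra.
  by rewrite addr_ge0 // mulr_ge0 // addr_ge0 // mulr_ge0 // ltW.
nra.
Qed.

End Rates.

(** A single server has no choice: on alternating requests to 1 and 0, A pays [2 * N], which the
    offline cost does not exceed. *)
Lemma robust1 (R : realType) (A : alg R) (b : R) : valid_alg A -> robust A 1 b -> 1 <= b.
Proof.
move=> vA [c Hc]; rewrite leNgt; apply/negP => b1.
pose trip := [:: (1 : R, 0%N); (0, 0%N)].
pose s N := flatten (nseq N trip).
have sing (C : seq R) r : size C = 1 -> A C r 0 = [:: r].
  move=> sC; have [||e rin] := vA C r 0; rewrite ?sC //.
  by move: e rin; case: (A C r 0) => [|z [|]] //; rewrite sC // inE => _ /eqP->.
have d1 (u v : R) : dist [:: u] [:: v] = `|u - v| by rewrite /dist big_ord1.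
have cA N : alg_cost A [:: 0] (s N) = 2 * N%:R.
  elim: N => [|N IH]; first by rewrite mulr0.
  rewrite /s /= !sing // !d1 -/(s N) IH sub0r subr0 normrN normr1 -natr1; lra.
have vs N : valid_preds 1 (s N) by elim: N.
have oN N : OPT [:: 0] (map fst (s N)) <= 2 * N%:R.
  apply: le_trans (OPT_le_sched (_ : sched_ok _ _ [seq [:: x.1] | x <- s N])) _.
    suff h (C : seq R) : size C = 1 -> sched_ok C (map fst (s N)) [seq [:: x.1] | x <- s N].
      exact: h.
    by elim: (s N) C => //= x t IH C ->; rewrite inE eqxx IH.
  elim: N => [|N IH]; first by rewrite mulr0.
  move: IH; rewrite /s /= !d1 sub0r subr0 normrN normr1 -natr1 => IH; lra.
pose b0 := Num.max b 0.
have b01 : b0 < 1 by rewrite gt_max b1 ltr01.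
have b0_ge : 0 <= b0 by rewrite le_max lexx orbT.
have H N : (1 - b0) * (2 * N%:R) <= c [:: 0].
  have := Hc [:: 0] (s N) erefl (vs N); rewrite cA.
  have : b * OPT [:: 0] (map fst (s N)) <= b0 * (2 * N%:R).
    apply: le_trans (_ : b0 * OPT [:: 0] (map fst (s N)) <= _); last exact: ler_wpM2l.
    by apply: ler_wpM2r; [exact: OPT_ge0 | rewrite le_max lexx].
  lra.
have := H (Num.bound (`|c [:: 0]| / (1 - b0))).
have := archi_boundP (divr_ge0 (normr_ge0 (c [:: 0])) (ltW (_ : 0 < 1 - b0))).
rewrite subr_gt0 => /(_ b01); rewrite ltr_pdivrMr ?subr_gt0 //.
have := ler_norm (c [:: 0]); have := normr_ge0 (c [:: 0]).
move: (Num.bound _)%:R => N; move: `|_| => m h1 h2 h3 h4.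
suff : m < m by rewrite ltxx.
nra.
Qed.

Theorem theorem2 (R : realType) (lam : R) (k : nat) (A : alg R) :
  0 < lam <= 1 -> (0 < k)%N ->
  valid_alg A -> memory_constrained A -> locally_consistent A (rho lam) ->
  consistent A k (rho lam k) ->
  forall beta' : R, beta' < beta lam k -> ~ robust A k beta'.
Proof.
move=> lam01 + vA _ [_ [B [K loc]]] _ b; case: k => // -[|m] _ bb rob.
  have := robust1 vA rob; rewrite leNgt => /negP; apply; apply: lt_le_trans bb _.
  by rewrite /beta big_ord1 expr0 invr1.
set n := m.+1 in bb rob *; have n0 : (0 < n)%N by [].
have mu0 := rho_ge0 lam01.
have [c Hc] := rob.
set C0 := sites (rho lam) K n n.+1.
have sC0 : size C0 = n.+1 by rewrite size_mkseq.
pose Bp := `|B C0|; have Bp0 : 0 <= Bp by exact: normr_ge0.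
(* [b] may be negative; a nonnegative factor is needed to multiply the upper bound on [OPT]. *)
pose b0 := Num.max b 0.
have b0_ge : 0 <= b0 by rewrite le_max lexx orbT.
have b0b : b <= b0 by rewrite le_max lexx.
have b0_lt : b0 < beta lam n.+1 by rewrite gt_max bb beta_gt0.
pose L0 := dist C0 (parked (rho lam) K n 1).
pose D := rate_loss lam Bp n / lam ^+ n.
(* [up] and [low] combine to [(beta lam n.+1 - b0) * (2 * N) <= E]. [H] is the resulting bound on
   the cost; it is independent of the run, which is then chosen to cost more. *)
pose E := b0 * L0 + `|c C0| + D.
pose H := b0 * (L0 + E / (beta lam n.+1 - b0)) + `|c C0|.
have lamn : 0 < lam ^+ n by apply: exprn_gt0; case/andP: lam01.
have D0 : 0 <= D by rewrite divr_ge0 ?rate_loss_ge0 // ltW.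
have L00 : 0 <= L0 by exact: dist_ge0.
have E0 : 0 <= E by rewrite /E addr_ge0 // addr_ge0 // mulr_ge0.
have H0 : 0 <= H.
  by rewrite /H addr_ge0 // mulr_ge0 // addr_ge0 // divr_ge0 // subr_ge0 ltW.
have [s [gs cs]] := good_run vA mu0 loc n0 (Num.bound H).
rewrite -/C0 in gs cs; have [rs _ _ _] := gs.
have vs : valid_preds n.+1 s by exact: requests_ok_valid rs.
pose N := (count (fun x : R * nat => x.2 == 0%N) s)%:R : R.
pose P := alg_cost A C0 s.
have PT : P = \sum_(i < n.+1) srv_path A i C0 s by rewrite /P alg_costE ?sC0.
have up : P <= b0 * (L0 + 2 * N) + `|c C0|.
  apply: le_trans (Hc C0 s sC0 vs) _; apply: lerD; last exact: ler_norm.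
  apply: le_trans (_ : b0 * OPT C0 (map fst s) <= _); first by rewrite ler_wpM2r ?OPT_ge0.
  by apply: ler_wpM2l => //; exact: OPT_le.
have low : beta lam n.+1 * (2 * N) - D <= P.
  have chain := @rate_chain _ lam lam01 Bp (fun i => srv_path A i C0 s) n Bp0
    (fun j => srv_path_ge0 A j C0 s) _ n (leqnn n).
  have {}chain : rho lam n.+1 * srv_path A 0 C0 s - rate_loss lam Bp n <= lam ^+ n * P.
    rewrite PT; apply: chain => i i0 iin.
    apply: le_trans (prefix_block vA mu0 loc n0 i0 iin gs) _.
    by rewrite lerD2l ler_norm.
  have eD : lam ^+ n * D = rate_loss lam Bp n by rewrite /D mulrC divfK ?lt0r_neq0.
  rewrite -(ler_pM2l lamn); apply: le_trans chain.
  rewrite mulrBr (mulrA _ (beta lam n.+1)) (beta_rho lam01 n) eD lerD2r.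
  by apply: ler_wpM2l => //; exact: path0_ge gs.
have N2 : 2 * N <= E / (beta lam n.+1 - b0).
  by rewrite ler_pdivlMr ?subr_gt0 // /E; move: up low; nra.
have PH : P <= H.
  apply: le_trans up _; rewrite lerD2r; apply: ler_wpM2l => //.
  by rewrite lerD2l.
have := le_lt_trans PH (lt_le_trans (archi_boundP H0) cs).
by rewrite ltxx.
Qed.
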